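(* Let $p$ be a prime number, let $R\subseteq \mathbb{F}_p$ be the set of quadratic residues, and let $A\subseteq \mathbb{F}_p$. (1) If $A+A=R$, then $p=3$ and $A=\{2\}$. (2) If $A\hat{+}A=R$, then $p\in\{3,7,13\}$ and $A$ is one of exactly four sets: for $p=3$, $A=\{0,1\}$; for $p=7$, $A=\{3,5,6\}$; for $p=13$, $A=\{0,1,3,9\}$ or $A=\{0,4,10,12\}$.
   Context: $R$ is the set of nonzero squares in $\mathbb{F}_p$. For $A\subseteq\mathbb{F}_p$, $A+A=\{a+a' : a,a'\in A\}$ and $A\hat{+}A=\{a+a' : a,a'\in A,\ a\neq a'\}$.
   Formalization: Part (2) is stated for odd primes only, since for p = 2 the set A = {0,1} has restricted sumset {1} = R and contradicts the claim; part (1) covers every prime. *)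

(* Defs.v *)
From mathcomp Require Import all_boot all_algebra.

Set Implicit Arguments.
Unset Strict Implicit.
Unset Printing Implicit Defensive.

Import GRing.Theory.
Local Open Scope ring_scope.

Definition quadratic_residues (p : nat) : {set 'F_p} :=
  [set x : 'F_p | (x != 0) && [exists y : 'F_p, x == y ^+ 2]].

Definition sumset (p : nat) (A : {set 'F_p}) : {set 'F_p} :=
  [set a + b | a in A, b in A].

Definition restricted_sumset (p : nat) (A : {set 'F_p}) : {set 'F_p} :=
  [set a + b | a in A, b in A & a != b].

(* Main.v *)
Require Import Defs.
From mathcomp Require Import all_boot all_algebra all_solvable all_field.
From mathcomp Require Import zify ring.

Set Implicit Arguments.
Unset Strict Implicit.
Unset Printing Implicit Defensive.

Import GRing.Theory.
Local Open Scope ring_scope.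

(** Let [h = (p - 1) / 2], [n = #|A|], [g = \prod_(a in A) ('X - a)] and let
    [w a = 1 / g'(a)], so that [\sum_(a in A) w a * q(a)] vanishes for every
    polynomial [q] of degree less than [n - 1].  In the Stepanov polynomial
    [T = \sum_(a in A) w a * (X + a)^(h + m) * (X - a)^r - constant] the weights
    lower the degree to [h + m + r - (n - 1)], while [(a + b)^h = 1] forces zeros
    of high order at the points of [A]; the factor [(X - a)^r] hides the possibly
    non-square diagonal sum [a + a] up to order [r].

    If [A + A = R], take [r = 0] and [m = n - 1] (Hanson and Petridis): every
    point of [A] is a zero of order [n], so [n^2 <= h <= n (n + 1) / 2].

    If the restricted sumset is [R], take [r = n./2] and [m = r - 1].  Counting
    zeros against the bound [2 h <= n (n - 1)] forces [T = 0].  The coefficient of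
    [(X - b)^r] then gives [(2 b)^h = -1] and [g(-b) = - gamma b g'(b)] for [b] in
    [A], with [gamma] a nonzero binomial coefficient.  Hence
    [g(-X) + gamma X g'(X)] is a multiple of [g], which leaves only
    [g = X^n - c] ([n] odd) or [g = X^n - c X] ([n] even).  The choice [m = r]
    yields a nonzero polynomial and thereby [n (n - 1) = p - 1], so every residue
    has a unique representation and power sums over [A] can be compared with those
    over [R].  For [n > 3] odd this gives [2^(n - 1) = n] in ['F_p], which is
    impossible; for [n = q + 1 > 2] even it gives [2^(q - 1) = q + 1], hence
    [2^12 = 1] and [p = 13]. *)

(** * Lagrange interpolation on a finite set and its weights *)

Section Interpolation.

Variable F : finFieldType.
Implicit Types (A : {set F}) (q : {poly F}).

Definition vanishing_poly A : {poly F} := \prod_(a in A) ('X - a%:P).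

Definition weight A (a : F) : F := (vanishing_poly (A :\ a)).[a]^-1.

Lemma size_vanishing_poly A : size (vanishing_poly A) = #|A|.+1.
Proof. by rewrite /vanishing_poly -big_enum /= size_prod_XsubC -cardE. Qed.

Lemma monic_vanishing_poly A : vanishing_poly A \is monic.
Proof. exact: monic_prod_XsubC. Qed.

Lemma horner_vanishing_poly A z : (vanishing_poly A).[z] = \prod_(a in A) (z - a).
Proof. by rewrite horner_prod; apply: eq_bigr => a _; rewrite hornerXsubC. Qed.

Lemma vanishing_poly_eq0 A z : ((vanishing_poly A).[z] == 0) = (z \in A).
Proof.
rewrite horner_vanishing_poly prodf_seq_eq0 /=.
apply/hasP/idP => [[a _ /andP[aA]]|zA]; first by rewrite subr_eq0 => /eqP->.
by exists z; rewrite ?mem_index_enum // zA subrr eqxx.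
Qed.

Lemma vanishing_polyD1 A a : a \in A ->
  vanishing_poly A = ('X - a%:P) * vanishing_poly (A :\ a).
Proof. by move=> aA; rewrite /vanishing_poly (big_setD1 a). Qed.

Lemma weight_neq0 A a : weight A a != 0.
Proof. by rewrite invr_eq0 vanishing_poly_eq0 !inE eqxx. Qed.

Lemma deriv_vanishing_poly A a : a \in A ->
  ((vanishing_poly A)^`()).[a] = (weight A a)^-1.
Proof.
move=> aA; rewrite (vanishing_polyD1 aA) derivM derivXsubC mul1r.
by rewrite hornerD hornerM hornerXsubC subrr mul0r addr0 invrK.
Qed.

Lemma poly_vanishing_eq0 A q : (size q <= #|A|)%N -> {in A, forall a, q.[a] = 0} ->
  q = 0.
Proof.
move=> sq q0; apply/eqP; apply: contraLR sq => qn0.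
rewrite -ltnNge cardE; apply: max_poly_roots => //; last exact: enum_uniq.
by apply/allP => a; rewrite mem_enum => aA; apply/eqP/q0.
Qed.

Lemma interpolation A q : (size q <= #|A|)%N ->
  q = \sum_(a in A) (weight A a * q.[a]) *: vanishing_poly (A :\ a).
Proof.
move=> sq; apply/eqP; rewrite -subr_eq0; apply/eqP.
apply: (@poly_vanishing_eq0 A) => [|b bA].
  apply: leq_trans (size_polyD _ _) _; rewrite size_polyN geq_max sq /=.
  apply: leq_trans (size_sum _ _ _) _; apply/bigmax_leqP => a aA.
  apply: leq_trans (size_scale_leq _ _) _.
  by rewrite size_vanishing_poly (cardsD1 a A) aA.
rewrite hornerD hornerN horner_sum (bigD1 b) //= big1 => [|a /andP[aA ab]].
  rewrite hornerZ addr0 mulrAC mulVf ?mul1r ?subrr //.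
  by rewrite vanishing_poly_eq0 !inE eqxx.
apply/eqP; rewrite hornerZ mulf_eq0; apply/orP; right.
by rewrite vanishing_poly_eq0 !inE eq_sym ab.
Qed.

(** Compare top coefficients in the Lagrange formula: each basis polynomial
    [vanishing_poly (A :\ a)] is monic of degree [#|A|.-1]. *)
Lemma sum_weight A q : (size q <= #|A|)%N ->
  \sum_(a in A) weight A a * q.[a] = q`_(#|A|.-1).
Proof.
move=> sq; rewrite {2}(interpolation sq) coef_sum; apply: eq_bigr => a aA.
have := monicP (monic_vanishing_poly (A :\ a)).
rewrite lead_coefE size_vanishing_poly (cardsD1 a A) aA add1n coefZ => ->.
by rewrite mulr1.
Qed.

(** Partial fractions of 1/g: interpolate the constant 1, evaluate at [z] and divide by g(z). *)
Lemma sum_weight_inv A z : z \notin A -> A != set0 ->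
  \sum_(a in A) weight A a / (z - a) = ((vanishing_poly A).[z])^-1.
Proof.
move=> zA A0; have gz : (vanishing_poly A).[z] != 0 by rewrite vanishing_poly_eq0.
apply: (mulIf gz); rewrite mulVf // mulr_suml.
have s1 : (size (1%R : {poly F}) <= #|A|)%N by rewrite size_poly1 card_gt0.
have /(congr1 (fun f => f.[z])) := interpolation s1.
rewrite hornerC horner_sum => ->; apply: eq_bigr => a aA.
rewrite (vanishing_polyD1 aA) hornerZ hornerM hornerXsubC hornerC mulr1.
by rewrite mulrA mulfVK // subr_eq0; apply: contraNneq zA => ->.
Qed.

End Interpolation.

(** * Taylor coefficients and zeros of high order *)

Section Taylor.

Variable F : fieldType.
Implicit Types (q : {poly F}).

Lemma coef_XaddC_exp (c : F) n k : (('X + c%:P) ^+ n)`_k = c ^+ (n - k) *+ 'C(n, k).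
Proof.
rewrite addrC exprDn coef_sum.
case: (ltnP n k) => [nk|kn].
  rewrite bin_small // mulr0n big1 // => i _.
  rewrite coefMn -polyC_exp coefCM coefXn (_ : k == i = false) ?mulr0 ?mul0rn //.
  by apply/eqP => ki; have := ltn_ord i; rewrite -ki ltnS leqNgt nk.
rewrite (bigD1 (Ordinal (kn : (k < n.+1)%N))) //= big1 => [|i ik].
  by rewrite addr0 coefMn -polyC_exp coefCM coefXn eqxx mulr1.
rewrite coefMn -polyC_exp coefCM coefXn (_ : k == i = false) ?mulr0 ?mul0rn //.
by apply: contraNF ik => /eqP ki; apply/eqP/val_inj.
Qed.

Lemma dvdp_XsubC_exp_taylor q (b : F) r :
  (forall k, (k < r)%N -> (q \Po ('X + b%:P))`_k = 0) -> ('X - b%:P) ^+ r %| q.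
Proof.
move=> q0; pose t := q \Po ('X + b%:P).
have qt : q = t \Po ('X - b%:P).
  by rewrite -comp_polyA comp_polyD comp_polyX comp_polyC subrK comp_polyXr.
rewrite qt -(poly_take_drop r t).
rewrite (_ : take_poly r t = 0) ?add0r.
  by rewrite comp_polyM comp_Xn_poly dvdp_mull.
by apply/polyP => k; rewrite coef_take_poly coef0; case: ifP => // /q0.
Qed.

Lemma dvdp_prod_XsubC_exp (s : seq F) r q : uniq s ->
  {in s, forall b, ('X - b%:P) ^+ r %| q} -> \prod_(b <- s) ('X - b%:P) ^+ r %| q.
Proof.
elim: s => [|b s IHs] /=; first by rewrite big_nil dvd1p.
move=> /andP[bs us] dq; rewrite big_cons Gauss_dvdp; last first.
  rewrite prodrXl coprimep_expl // coprimep_expr //.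
  by rewrite coprimep_sym coprimep_XsubC root_prod_XsubC.
rewrite dq ?mem_head //=; apply: IHs => // c cs; apply: dq.
by rewrite in_cons cs orbT.
Qed.

Lemma size_prod_XsubC_exp (s : seq F) r :
  size (\prod_(b <- s) ('X - b%:P) ^+ r) = (size s * r).+1.
Proof.
rewrite prodrXl -[LHS]prednK ?size_exp ?size_prod_XsubC //.
by rewrite size_poly_gt0 expf_neq0 // monic_neq0 // monic_prod_XsubC.
Qed.

End Taylor.

(** * The Stepanov polynomial: degree bound and Taylor coefficients at points of [A] *)

Section Stepanov.

Variable F : finFieldType.
Implicit Types (A : {set F}) (b : F).

Definition stepanov A M r : {poly F} :=
  \sum_(a in A) weight A a *: (('X + a%:P) ^+ M * ('X - a%:P) ^+ r).

(** After the shift by [b] both factors are binomial powers, and this is their product in degree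
    [k]. Where a truncated subtraction hits 0 wrongly, a binomial coefficient vanishes. *)
Lemma coef_stepanov_taylor A M r b k :
  (stepanov A M r \Po ('X + b%:P))`_k =
  \sum_(l < k.+1)
    (\sum_(a in A) weight A a * ((a + b) ^+ (M - l) * (b - a) ^+ (r - (k - l))))
      *+ ('C(M, l) * 'C(r, k - l)).
Proof.
rewrite /stepanov raddf_sum coef_sum /=.
under [RHS]eq_bigr do rewrite -sumrMnl.
rewrite exchange_big /=; apply: eq_bigr => a aA.
rewrite comp_polyZ coefZ comp_polyM !rmorphXn /= comp_polyD comp_polyB.
rewrite comp_polyX !comp_polyC.
rewrite (_ : 'X + b%:P + a%:P = 'X + (a + b)%:P); last by rewrite polyCD; ring.
rewrite (_ : 'X + b%:P - a%:P = 'X + (b - a)%:P); last by rewrite polyCB; ring.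
rewrite coefM mulr_sumr; apply: eq_bigr => l _.
by rewrite !coef_XaddC_exp !(mulrnAl, mulrnAr) -mulrnA mulnC.
Qed.

(** By [sum_weight] this is the coefficient of degree [#|A|.-1] in (X + b)^s (b - X)^e, whose
    leading coefficient is (-1)^e. *)
Lemma sum_weight_split A b s e : (s + e < #|A|)%N ->
  \sum_(a in A) weight A a * ((a + b) ^+ s * (b - a) ^+ e) =
  ((s + e).+1 == #|A|)%:R * (-1) ^+ e.
Proof.
move=> se; pose q := ('X + b%:P) ^+ s * ('X - b%:P) ^+ e.
have mq : q \is monic by rewrite monicMl ?monic_exp ?monicXsubC ?monicXaddC.
have sq : size q = (s + e).+1.
  rewrite size_Mmonic ?monic_neq0 ?monic_exp ?monicXsubC ?monicXaddC //.
  rewrite size_exp_XsubC -[b%:P]opprK -polyCN size_exp_XsubC; lia.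
have qE a : (a + b) ^+ s * (b - a) ^+ e = ((-1) ^+ e *: q).[a].
  by rewrite hornerZ hornerM !horner_exp !hornerE /= -opprB [LHS]mulrC [in LHS]exprNn; ring.
under eq_bigr do rewrite qE.
rewrite sum_weight; last by rewrite (leq_trans (size_scale_leq _ _)) ?sq.
rewrite coefZ mulrC; case: eqP => [seA|seA].
  by rewrite -seA /=; have := monicP mq; rewrite lead_coefE sq /= => ->.
by rewrite nth_default ?mul0r // sq; lia.
Qed.

(** The coefficient of degree j is a weighted sum of monomials in [a] of degree M + r - j, which
    vanishes once this is below #|A| - 1. *)
Lemma size_stepanov A M r d : ((M + r).+2 <= d + #|A|)%N ->
  (size (stepanov A M r) <= d)%N.
Proof.
move=> MrA; apply/leq_sizeP => j dj.
have -> : stepanov A M r = stepanov A M r \Po ('X + 0%:P).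
  by rewrite polyC0 addr0 comp_polyXr.
rewrite coef_stepanov_taylor big1 // => l _.
case: (ltnP M l) => [Ml|lM]; first by rewrite bin_small.
case: (ltnP r (j - l)) => [rl|lr]; first by rewrite (bin_small rl) muln0.
have lj : (l <= j)%N by rewrite -ltnS.
rewrite sum_weight_split; last by lia.
by rewrite (_ : _ == _ = false) ?mul0r ?mul0rn //; lia.
Qed.

(** The value of [sum_weight_split] at s = m, e = r. Subtracting it cancels the constant Taylor
    coefficient at points of [A]. *)
Definition stepanov_const A m r : F := ((m + r).+1 == #|A|)%:R * (-1) ^+ r.

Variable h : nat.

Definition shifted_stepanov A m r : {poly F} :=
  stepanov A (h + m) r - (stepanov_const A m r)%:P.

Lemma coef_shifted_stepanov A m r b k :
  (shifted_stepanov A m r \Po ('X + b%:P))`_k =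
  (stepanov A (h + m) r \Po ('X + b%:P))`_k - stepanov_const A m r *+ (k == 0).
Proof.
rewrite /shifted_stepanov comp_polyB comp_polyC coefB coefC.
by case: eqP.
Qed.

Lemma size_shifted_stepanov A m r d : (0 < d)%N ->
  ((h + m + r).+2 <= d + #|A|)%N -> (size (shifted_stepanov A m r) <= d)%N.
Proof.
move=> d0 hd; apply: leq_trans (size_polyD _ _) _.
rewrite geq_max size_stepanov // size_polyN.
by apply: leq_trans (size_polyC_leq1 _) _.
Qed.

Section AtPoint.

Variables (A : {set F}) (b : F).
Hypothesis Ab : {in A, forall a, a != b -> (a + b) ^+ h = 1}.

(** The factor (a + b)^h is 1 unless a = b, and that term is killed by (b - a)^e. This is how the
    uncontrolled diagonal sum is hidden. *)
Lemma sum_weight_char s e : (0 < e)%N ->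
  \sum_(a in A) weight A a * ((a + b) ^+ (h + s) * (b - a) ^+ e) =
  \sum_(a in A) weight A a * ((a + b) ^+ s * (b - a) ^+ e).
Proof.
move=> e0; apply: eq_bigr => a aA; have [->|ab] := eqVneq a b.
  by rewrite subrr expr0n gtn_eqF // !mulr0.
by rewrite exprD Ab // mul1r.
Qed.

Lemma coef_shifted_stepanov_small m r k : (m + r < #|A|)%N ->
  (k <= m)%N -> (k < r)%N ->
  (shifted_stepanov A m r \Po ('X + b%:P))`_k = 0.
Proof.
move=> mrA km kr; rewrite coef_shifted_stepanov coef_stepanov_taylor.
under eq_bigr => l _.
  have lk : (l <= k)%N by rewrite -ltnS.
  rewrite -addnBA; last by lia.
  rewrite sum_weight_char; last by lia.
  rewrite sum_weight_split; last by lia.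
  over.
case: k km kr => [|k] km kr.
  by rewrite big_ord1 !subn0 !bin0 muln1 !mulr1n subrr.
rewrite mulr0n subr0 big1 // => l _; have lk : (l <= k.+1)%N by rewrite -ltnS.
by rewrite (_ : _ == _ = false) ?mul0r ?mul0rn //; lia.
Qed.

Lemma dvdp_shifted_stepanov m r : (m + r < #|A|)%N -> (r <= m.+1)%N ->
  ('X - b%:P) ^+ r %| shifted_stepanov A m r.
Proof.
move=> mrA rm; apply: dvdp_XsubC_exp_taylor => k kr.
by apply: coef_shifted_stepanov_small => //; lia.
Qed.

Hypothesis bA : b \in A.

(** With exponent [m] in place of [h + m] the sum vanishes by degree, and the two sums differ only
    in the term a = b. *)
Lemma sum_weight_diag m : (m.+1 < #|A|)%N ->
  \sum_(a in A) weight A a * ((a + b) ^+ (h + m) * (b - a) ^+ 0) =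
  weight A b * (b + b) ^+ m * ((b + b) ^+ h - 1).
Proof.
move=> mA.
have /eqP : \sum_(a in A) weight A a * ((a + b) ^+ m * (b - a) ^+ 0) = 0.
  by rewrite sum_weight_split ?addn0 ?(ltnW mA) // ltn_eqF // mul0r.
rewrite (bigD1 b) //= addr_eq0 => /eqP w0; rewrite (bigD1 b) //=.
rewrite [X in _ + X](_ : _ =
   \sum_(a in A | a != b) weight A a * ((a + b) ^+ m * (b - a) ^+ 0)).
  by rewrite -[X in _ + X]opprK -w0 !expr0 exprD; ring.
by apply: eq_bigr => a /andP[aA ab]; rewrite exprD Ab // mul1r.
Qed.

(** In order exactly [r], the term [l] carries (b - a)^l, so only l = 0 sees the diagonal; the
    others vanish by degree. *)
Lemma coef_shifted_stepanov_diag m r : (0 < r)%N -> (m.+1 < #|A|)%N ->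
  (r <= m)%N ->
  (shifted_stepanov A m r \Po ('X + b%:P))`_r =
  weight A b * (b + b) ^+ m * ((b + b) ^+ h - 1).
Proof.
move=> r0 mA rm; rewrite coef_shifted_stepanov coef_stepanov_taylor.
rewrite (gtn_eqF r0) mulr0n subr0 big_ord_recl [X in _ + X]big1 => [|l _].
  by rewrite /= !subn0 bin0 binn subnn addr0 mulr1n sum_weight_diag.
rewrite lift0; have lr : (l.+1 <= r)%N := ltn_ord l.
rewrite -addnBA; last by lia.
rewrite sum_weight_char; last by lia.
rewrite sum_weight_split; last by lia.
by rewrite (_ : _ == _ = false) ?mul0r ?mul0rn //; lia.
Qed.

Hypothesis h_gt0 : (0 < h)%N.
Hypothesis b2 : b + b != 0.

Lemma addr_neq0 a : a \in A -> a + b != 0.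
Proof.
move=> aA; have [->//|ab] := eqVneq a b.
apply: contra_eq_neq (Ab aA ab) => ->.
by rewrite expr0n gtn_eqF // eq_sym oner_neq0.
Qed.

Lemma oppr_notin : - b \notin A.
Proof. by apply/negP => /addr_neq0; rewrite addNr eqxx. Qed.

Lemma sum_weight_inv_oppr :
  \sum_(a in A) weight A a / (a + b) = - ((vanishing_poly A).[- b])^-1.
Proof.
have A0 : A != set0 by apply/set0Pn; exists b.
rewrite -(sum_weight_inv oppr_notin A0) -sumrN; apply: eq_bigr => a aA.
by rewrite -opprD invrN mulrN opprK addrC.
Qed.

(** As (b - a) - 2b = -(a + b), replacing (b - a)^r by (2b)^r changes the quotient by a polynomial
    in [a] of degree below #|A| - 1, which the weights kill. A simple pole remains. *)
Lemma sum_weight_pole r : (r < #|A|)%N ->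
  \sum_(a in A) weight A a * ((b - a) ^+ r / (a + b)) =
  - ((b + b) ^+ r / (vanishing_poly A).[- b]).
Proof.
move=> rA; rewrite -mulrN -sum_weight_inv_oppr mulr_sumr.
apply/eqP; rewrite -subr_eq0 -sumrB.
rewrite (eq_bigr (fun a => - \sum_(i < r)
    (b + b) ^+ i * (weight A a * ((a + b) ^+ 0 * (b - a) ^+ (r - i.+1))))).
  rewrite sumrN exchange_big big1 ?oppr0 //= => i _.
  rewrite -mulr_sumr sum_weight_split ?add0n; last by have := ltn_ord i; lia.
  by rewrite (_ : _ == _ = false) ?mul0r ?mulr0 //; have := ltn_ord i; lia.
move=> a aA; have ab := addr_neq0 aA.
transitivity (weight A a / (a + b) * ((b - a) ^+ r - (b + b) ^+ r)); first by ring.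
rewrite subrXX (_ : b - a - (b + b) = - (a + b)); last by ring.
rewrite mulNr mulrN mulrA mulfVK // mulr_sumr; congr (- _).
apply: eq_bigr => i _; rewrite (_ : r.-1 - i = r - i.+1)%N; last by lia.
by ring.
Qed.

(** Two terms survive: l = 0 gives the diagonal, and l = m + 1 has exponent h - 1, where (a + b)^(h
    - 1) = 1/(a + b) off the diagonal gives a pole. *)
Lemma coef_shifted_stepanov_edge m : (m.+1 < #|A|)%N ->
  (shifted_stepanov A m m.+1 \Po ('X + b%:P))`_m.+1 =
  weight A b * (b + b) ^+ m * ((b + b) ^+ h - 1)
  - (b + b) ^+ m.+1 / (vanishing_poly A).[- b] *+ 'C(h + m, m.+1).
Proof.
move=> mA; rewrite coef_shifted_stepanov coef_stepanov_taylor.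
rewrite mulr0n subr0 big_ord_recr big_ord_recl /= [X in _ + X + _]big1 => [|l _].
  rewrite !subn0 subnn !bin0 binn muln1 subn0 addr0 mulr1n.
  rewrite sum_weight_diag //; congr (_ + _).
  rewrite -mulNrn muln1; congr (_ *+ _); rewrite -(sum_weight_pole mA).
  apply: eq_bigr => a aA; have [->|ab] := eqVneq a b.
    by rewrite subrr expr0n /= mul0r !mulr0.
  rewrite [_ / _]mulrC; congr (_ * (_ * _)).
  apply: (mulIf (addr_neq0 aA)); rewrite mulVf ?addr_neq0 // -exprSr.
  by rewrite (_ : (h + m - m.+1).+1 = h) ?Ab //; lia.
rewrite /bump /= add1n; have lm : (l < m)%N := ltn_ord l.
rewrite -addnBA; last by lia.
rewrite sum_weight_char; last by lia.
rewrite sum_weight_split; last by lia.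
by rewrite (_ : _ == _ = false) ?mul0r ?mul0rn //; lia.
Qed.

End AtPoint.

Section AllSums.

Variables (A : {set F}) (b : F) (n : nat).
Hypothesis cardA : #|A| = n.+1.
Hypothesis Ab : {in A, forall a, (a + b) ^+ h = 1}.

Lemma coef_stepanov_r0 M k : (stepanov A M 0 \Po ('X + b%:P))`_k =
  (\sum_(a in A) weight A a * (a + b) ^+ (M - k)) *+ 'C(M, k).
Proof.
rewrite coef_stepanov_taylor big_ord_recr /= subnn bin0 muln1 big1 => [|l _].
  by rewrite add0r; under eq_bigr do rewrite expr0 mulr1.
by rewrite (@bin_small 0) ?muln0 // subn_gt0.
Qed.

Lemma dvdp_shifted_stepanov_r0 : ('X - b%:P) ^+ n.+1 %| shifted_stepanov A n 0.
Proof.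
apply: dvdp_XsubC_exp_taylor => k; rewrite ltnS => kn.
rewrite coef_shifted_stepanov coef_stepanov_r0 -addnBA //.
have := @sum_weight_split A b (n - k) 0.
rewrite addn0 cardA eqSS => /(_ _)/[!expr0]; rewrite /stepanov_const addn0 cardA eqxx.
move=> w; under eq_bigr => a aA do rewrite exprD Ab // mul1r -[_ ^+ _]mulr1.
rewrite w; last by lia.
case: k kn {w} => [|k] kn; first by rewrite subn0 eqxx bin0 expr0 subrr.
by rewrite (_ : _ == _ = false) ?mul0r ?mul0rn ?subr0 //; lia.
Qed.

Hypothesis h_gt0 : (0 < h)%N.
Hypothesis bA : b \in A.
Hypothesis b2 : b + b != 0.

(** One order past the forced zeros the exponent drops to h - 1, so the power becomes 1/(a + b).
    This serves to prove the polynomial nonzero. *)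
Lemma coef_shifted_stepanov_r0 :
  (shifted_stepanov A n 0 \Po ('X + b%:P))`_n.+1 =
  - ((vanishing_poly A).[- b])^-1 *+ 'C(h + n, n.+1).
Proof.
have Ab' : {in A, forall a, a != b -> (a + b) ^+ h = 1} by move=> a aA _; apply: Ab.
rewrite coef_shifted_stepanov coef_stepanov_r0 mulr0n subr0.
rewrite -(sum_weight_inv_oppr Ab') //; congr (_ *+ _); apply: eq_bigr => a aA.
congr (_ * _); have ab := addr_neq0 Ab' h_gt0 b2 aA.
apply: (mulIf ab); rewrite mulVf // -exprSr.
by rewrite (_ : (h + n - n.+1).+1 = h) ?Ab //; lia.
Qed.

End AllSums.
End Stepanov.

(** * Sets whose polynomial satisfies the reflection identity *)

Section Reflection.

Variables (F : finFieldType) (A : {set F}) (gamma : F).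
Hypothesis gamma_neq0 : gamma != 0.
Hypothesis natF_neq0 : forall k, (0 < k <= #|A|)%N -> k%:R != 0 :> F.
Hypothesis card_gt1 : (1 < #|A|)%N.
Local Notation g := (vanishing_poly A).
Local Notation n := #|A|.
Hypothesis reflection : {in A, forall b, g.[- b] = - gamma * (b * g^`().[b])}.

(** The polynomial g(-X) + gamma X g'(X) has degree at most n and vanishes on [A], so it is its
    coefficient of degree n times [g]. The difference is [P]. *)
Lemma coef_reflection j : (j <= n)%N ->
  ((-1) ^+ j + gamma * j%:R) * g`_j = ((-1) ^+ n + gamma * n%:R) * g`_j.
Proof.
move=> jn; have sg : size g = n.+1 := size_vanishing_poly A.
pose P := \poly_(i < n.+1)
  (((-1) ^+ i + gamma * i%:R - ((-1) ^+ n + gamma * n%:R)) * g`_i).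
suff P0 : P = 0.
  have /eqP := congr1 (fun q : {poly F} => q`_j) P0.
  by rewrite coef_poly ltnS jn coef0 mulrBl subr_eq0 => /eqP.
apply: (@poly_vanishing_eq0 _ A) => [|b bA].
  apply/leq_sizeP => i ni; rewrite coef_poly; case: ifP => // ilt.
  by rewrite (_ : i = n) ?subrr ?mul0r //; lia.
have gb : g.[b] = 0 by apply/eqP; rewrite vanishing_poly_eq0.
have xg : b * g^`().[b] = \sum_(i < n.+1) g`_i *+ i * b ^+ i.
  transitivity ('X * g^`()).[b]; first by rewrite hornerM hornerX.
  rewrite (@horner_coef_wide _ n.+1).
    apply: eq_bigr => -[[|i] /= _] _; rewrite coefXM /= ?mulr0n //.
    by rewrite coef_deriv.
  rewrite (leq_trans (size_polyMleq _ _)) // size_polyX add2n /=.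
  by rewrite -sg lt_size_deriv // -size_poly_gt0 sg.
have gN : g.[- b] = \sum_(i < n.+1) (-1) ^+ i * g`_i * b ^+ i.
  rewrite (@horner_coef_wide _ n.+1) ?sg //; apply: eq_bigr => i _.
  by rewrite (exprNn b) mulrCA mulrA.
have gP : g.[b] = \sum_(i < n.+1) g`_i * b ^+ i by rewrite horner_coef sg.
transitivity (g.[- b] + gamma * (b * g^`().[b])
              - ((-1) ^+ n + gamma * n%:R) * g.[b]).
  rewrite xg gN gP horner_poly !mulr_sumr -sumrN -!big_split /=.
  by apply: eq_bigr => i _; rewrite -[g`_i *+ i]mulr_natr; ring.
by rewrite gb reflection //; ring.
Qed.

(** For equal parities the signs in [coef_reflection] cancel, leaving gamma (n - j) times the
    coefficient equal to 0. *)
Lemma coef_reflection_odd j : (j < n)%N -> g`_j != 0 -> odd j != odd n.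
Proof.
move=> jn gj; apply: contra_neqN gj => /eqP jno.
have := coef_reflection (ltnW jn); rewrite -[in LHS]signr_odd jno signr_odd.
move/eqP; rewrite -subr_eq0 -mulrBl opprD addrACA subrr add0r -mulrBr.
rewrite mulf_eq0 -opprB mulrN oppr_eq0 -natrB 1?ltnW // mulf_eq0.
have /negPf -> : (n - j)%:R != 0 :> F by apply: natF_neq0; lia.
by rewrite (negPf gamma_neq0) => /eqP.
Qed.

Lemma coef_reflection_inj i j : (i <= j < n)%N -> g`_i != 0 -> g`_j != 0 -> i = j.
Proof.
move=> /andP[ij jn] gi gj; have iltn := leq_ltn_trans ij jn.
have := coef_reflection_odd iltn gi; have := coef_reflection_odd jn gj.
move=> oj oi; have oij : odd i = odd j by case: (odd n) oi oj; do 2!case: odd.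
have /(mulIf gi) ei := coef_reflection (ltnW iltn).
have /(mulIf gj) := coef_reflection (ltnW jn).
rewrite -ei -signr_odd -oij signr_odd => /addrI/(mulfI gamma_neq0)/eqP.
rewrite -subr_eq0 -natrB // => nji; apply/eqP; apply: contraLR nji => nij.
by apply: natF_neq0; lia.
Qed.

Lemma vanishing_poly_coef0 : 0 \in A -> g`_0 = 0 /\ g`_1 != 0.
Proof.
move=> A0; split.
  by apply/eqP; rewrite -horner_coef0 vanishing_poly_eq0.
have := deriv_vanishing_poly A0; rewrite horner_coef0 coef_deriv mulr1n => ->.
by rewrite invr_eq0 weight_neq0.
Qed.

Lemma vanishing_poly_reflection j : (j < n)%N -> g`_j != 0 ->
  g = 'X^n + g`_j *: 'X^j.
Proof.
move=> jn gj; have sg := size_vanishing_poly A.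
have gn : g`_n = 1.
  by have := monicP (monic_vanishing_poly A); rewrite lead_coefE sg.
apply/polyP => i; rewrite coefD coefZ !coefXn; case: (ltngtP i n) => [ilt|ni|->].
- have [->|ij] := eqVneq i j; first by rewrite mulr1 add0r.
  rewrite mulr0 addr0; apply/eqP; apply: contra_neqT ij => gi.
  by case: (leqP i j) => ij; [|apply/esym]; apply: coef_reflection_inj => //; lia.
- by rewrite nth_default ?sg // gtn_eqF ?mulr0 ?addr0 // (ltn_trans jn).
- by rewrite gn gtn_eqF // mulr0 addr0.
Qed.

Lemma reflection_odd : odd n -> exists2 c, c != 0 & {in A, forall a, a ^+ n = c}.
Proof.
move=> no; have A0 : 0 \notin A.
  apply/negP => /vanishing_poly_coef0[_ /(coef_reflection_odd card_gt1)].
  by rewrite no.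
have g0 : g`_0 != 0 by rewrite -horner_coef0 vanishing_poly_eq0.
exists (- g`_0); first by rewrite oppr_eq0.
move=> a aA; have := vanishing_poly_eq0 A a; rewrite aA => /eqP.
have n0 : (0 < n)%N by lia.
rewrite {1}(vanishing_poly_reflection n0 g0) expr0 hornerD hornerZ hornerXn hornerC.
by rewrite mulr1 => /eqP; rewrite addr_eq0 => /eqP.
Qed.

Lemma reflection_even : ~~ odd n -> 0 \in A /\
  exists2 c, c != 0 & {in A, forall a, a != 0 -> a ^+ n.-1 = c}.
Proof.
move=> ne; have n0 : (0 < n)%N by lia.
have A0 : 0 \in A.
  rewrite -vanishing_poly_eq0 horner_coef0; apply/negPn/negP.
  by move/(coef_reflection_odd n0); rewrite (negPf ne).
split=> //; have [_ g1] := vanishing_poly_coef0 A0.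
exists (- g`_1); first by rewrite oppr_eq0.
move=> a aA a0; have := vanishing_poly_eq0 A a; rewrite aA => /eqP.
rewrite {1}(vanishing_poly_reflection card_gt1 g1) hornerD hornerZ !hornerXn expr1.
rewrite -{1}(prednK n0) exprSr -mulrDl => /eqP; rewrite mulf_eq0 (negPf a0) orbF.
by rewrite addr_eq0 => /eqP.
Qed.

End Reflection.

(** * Prime field arithmetic and quadratic residues *)

Lemma prime_ndvd_fact p N : prime p -> (N < p)%N -> ~~ (p %| N`!)%N.
Proof.
move=> p_pr; elim: N => [|N IHN] Np; first by rewrite dvdn1 neq_ltn prime_gt1 ?orbT.
by rewrite factS Euclid_dvdM // negb_or IHN 1?ltnW // gtnNdvd.
Qed.

Section Residues.

Variable p : nat.
Hypothesis p_prime : prime p.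
Hypothesis p_odd : odd p.
Local Notation F := 'F_p.
Local Notation h := p./2.
Local Notation R := (quadratic_residues p).

Lemma half_p : p = h.*2.+1.
Proof. by rewrite -[LHS]odd_double_half p_odd. Qed.

Lemma half_p_gt0 : (0 < h)%N.
Proof. by have := half_p; have := prime_gt1 p_prime; lia. Qed.

Lemma Fp_nat_eq0 k : (k%:R == 0 :> F) = (p %| k)%N.
Proof. by rewrite (dvdn_pcharf (pchar_Fp p_prime)). Qed.

Lemma Fp_nat_neq0 k : (0 < k < p)%N -> k%:R != 0 :> F.
Proof. by case/andP=> k0 kp; rewrite Fp_nat_eq0 gtnNdvd. Qed.

Lemma Fp_two_neq0 : 2%:R != 0 :> F.
Proof. by apply: Fp_nat_neq0; have := half_p; have := half_p_gt0; lia. Qed.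

Lemma Fp_double_neq0 (b : F) : b != 0 -> b + b != 0.
Proof. by move=> b0; rewrite -mulr2n -mulr_natl mulf_neq0 // Fp_two_neq0. Qed.

Lemma Fp_one_neq_opp : 1 != -1 :> F.
Proof. by rewrite -subr_eq0 opprK -[1 + 1]/(2%:R) Fp_two_neq0. Qed.

Lemma Fp_bin_neq0 N k : (k <= N < p)%N -> 'C(N, k)%:R != 0 :> F.
Proof.
case/andP=> kN Np; rewrite Fp_nat_eq0; apply: contra (prime_ndvd_fact p_prime Np).
by move=> pC; rewrite -(bin_fact kN) dvdn_mulr.
Qed.

Lemma Fp_exp_pred (x : F) : x != 0 -> x ^+ p.-1 = 1.
Proof.
move=> x0; apply: (mulIf x0); rewrite -exprSr prednK ?prime_gt0 // mul1r.
by have := expf_card x; rewrite card_Fp.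
Qed.

Lemma Fp_exp_half_sqr (x : F) : x != 0 -> x ^+ h ^+ 2 = 1.
Proof.
move=> x0; rewrite -exprM (_ : (h * 2)%N = p.-1) ?Fp_exp_pred //.
by have := half_p; lia.
Qed.

Lemma Fp_exp_half (x : F) : x != 0 -> x ^+ h != 1 -> x ^+ h = -1.
Proof.
move=> x0 xh; have /eqP := Fp_exp_half_sqr x0.
by rewrite sqrf_eq1 (negPf xh) => /eqP.
Qed.

Lemma residue_neq0 (x : F) : x \in R -> x != 0.
Proof. by rewrite inE => /andP[]. Qed.

Lemma residue_exp_half (x : F) : x \in R -> x ^+ h = 1.
Proof.
rewrite inE => /andP[x0 /existsP[y /eqP xy]]; move: x0; rewrite xy sqrf_eq0 => y0.
by rewrite exprAC Fp_exp_half_sqr.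
Qed.

Lemma residueM (x y : F) : x \in R -> (x * y \in R) = (y \in R).
Proof.
rewrite !inE => /andP[x0 /existsP[z /eqP xz]]; rewrite mulf_eq0 (negPf x0) /=.
case: (y == 0) => //=; move: x0; rewrite xz sqrf_eq0 => z0.
apply/existsP/existsP => -[t /eqP]; last by move->; exists (z * t); rewrite exprMn.
move=> zyt; exists (t / z); rewrite exprMn -zyt exprVn mulrAC mulfV ?mul1r //.
by rewrite sqrf_eq0.
Qed.

Lemma card_residues : #|R| = h.
Proof.
apply/eqP; rewrite eqn_leq; apply/andP; split.
  rewrite cardE; apply: max_unity_roots; rewrite ?enum_uniq ?half_p_gt0 //.
  apply/allP => x; rewrite mem_enum => /residue_exp_half xh.
  by rewrite unity_rootE xh.
have cardN : #|[set~ (0 : F)]| = h.*2.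
  by rewrite cardsC1 card_Fp //; have := half_p; lia.
(* Lower bound: squaring maps the 2h nonzero elements to residues, at most two to one. *)
rewrite -leq_double -cardN -sum1_card.
rewrite (partition_big (fun x : F => x ^+ 2) (fun r => r \in R)) /=; last first.
  move=> x; rewrite !inE => x0; rewrite sqrf_eq0 x0.
  by apply/existsP; exists x.
rewrite -mul2n mulnC -sum_nat_const; apply: leq_sum => r.
rewrite inE => /andP[_ /existsP[z /eqP rz]]; rewrite sum1_card.
apply: leq_trans (_ : #|[set z; - z]| <= 2)%N; last by rewrite cards2; case: eqP.
apply: subset_leq_card; apply/subsetP => x /andP[_].
by rewrite rz eqf_sqr !inE.
Qed.

(** Since k < h = #|R|, some residue y has y^k != 1; multiplication by y permutes R and scales the
    sum by y^k. *)
Lemma sum_residues_exp k : (0 < k < h)%N -> \sum_(x in R) x ^+ k = 0.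
Proof.
case/andP=> k0 kh.
have /subsetPn[y yR yk] : ~~ (R \subset [set x : F | x ^+ k == 1]).
  apply/negP => /subsetP Rk; move: kh; rewrite -card_residues ltnNge => /negP[].
  rewrite cardE; apply: max_unity_roots; rewrite ?enum_uniq //.
  by apply/allP => x; rewrite mem_enum => /Rk; rewrite inE unity_rootE.
have y0 := residue_neq0 yR.
have : \sum_(x in R) x ^+ k = y ^+ k * \sum_(x in R) x ^+ k.
  rewrite [LHS](reindex_inj (mulfI y0)) mulr_sumr /=.
  apply: eq_big => [x|x _]; first exact: residueM.
  by rewrite exprMn.
move/eqP; rewrite -subr_eq0 -{1}[X in X - _]mul1r -mulrBl mulf_eq0 subr_eq0.
by rewrite inE eq_sym in yk; rewrite (negPf yk) => /eqP.
Qed.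

End Residues.

(** * Counting ordered representations as sums of distinct elements *)

Section Representations.

Variable p : nat.
Variable A : {set 'F_p}.
Local Notation F := 'F_p.
Local Notation W := (restricted_sumset A).
Local Notation n := #|A|.

Definition off_diagonal : pred (F * F) :=
  [pred xy | [&& xy.1 \in A, xy.2 \in A & xy.1 != xy.2]].

Definition representations (r : F) : nat :=
  #|[pred xy | off_diagonal xy & xy.1 + xy.2 == r]|.

Lemma sum_off_diagonal (V : nmodType) (f : F -> F -> V) :
  \sum_(xy | off_diagonal xy) f xy.1 xy.2 =
  \sum_(x in A) \sum_(y in A | x != y) f x y.
Proof. by rewrite pair_big_dep /=. Qed.

Lemma card_off_diagonal : #|off_diagonal| = (n * n.-1)%N.
Proof.
rewrite -sum_nat_const -(sum1_card off_diagonal).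
transitivity (\sum_(x in A) \sum_(y in A | x != y) 1)%N.
  by rewrite pair_big_dep.
apply: eq_bigr => x xA; rewrite sum1_card (cardsD1 x A) xA /=.
by apply: eq_card => y; rewrite !inE andbC eq_sym.
Qed.

Lemma mem_restricted_sumset a b : a \in A -> b \in A -> a != b -> a + b \in W.
Proof.
by move=> aA bA ab; apply/imset2P; exists a b; rewrite ?inE ?bA.
Qed.

Lemma sum_representations (V : nmodType) (f : F -> V) :
  \sum_(x in A) \sum_(y in A | x != y) f (x + y) =
  \sum_(r in W) f r *+ representations r.
Proof.
rewrite -(@sum_off_diagonal V (fun x y => f (x + y))).
rewrite (partition_big (fun xy : F * F => xy.1 + xy.2) (fun r => r \in W)) /=.
  apply: eq_bigr => r _; rewrite -sumr_const; apply: eq_bigr => xy.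
  by case/andP=> _ /eqP->.
by move=> xy /and3P[]; apply: mem_restricted_sumset.
Qed.

Lemma representations_ge2 r : r \in W -> (2 <= representations r)%N.
Proof.
case/imset2P=> a b aA; rewrite inE => /andP[bA ab] ->.
have <- : #|[set (a, b); (b, a)]| = 2%N.
  by rewrite cards2 xpair_eqE negb_and ab.
apply: subset_leq_card; apply/subsetP => xy.
rewrite !inE => /orP[]/eqP->; apply/andP; split=> //=.
- exact/and3P.
- by apply/and3P; rewrite eq_sym.
- by rewrite addrC.
Qed.

Lemma sum_card_representations : (\sum_(r in W) representations r = n * n.-1)%N.
Proof.
rewrite -card_off_diagonal -sum1_card.
rewrite (partition_big (fun xy : F * F => xy.1 + xy.2) (fun r => r \in W)) /=.
  by apply: eq_bigr => r _; rewrite sum1_card.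
by move=> xy /and3P[]; apply: mem_restricted_sumset.
Qed.

Lemma card_restricted_sumset_le : (#|W|.*2 <= n * n.-1)%N.
Proof.
rewrite -sum_card_representations -mul2n mulnC -sum_nat_const.
by apply: leq_sum => r; apply: representations_ge2.
Qed.

(** Each element of [W] has at least two ordered representations; equality in the total count forces
    exactly two. *)
Lemma sum_restricted_sums (V : nmodType) (f : F -> V) : (n * n.-1 <= #|W|.*2)%N ->
  \sum_(x in A) \sum_(y in A | x != y) f (x + y) = (\sum_(r in W) f r) *+ 2.
Proof.
move=> nW; rewrite sum_representations -sumrMnl; apply: eq_bigr => r rW.
suff -> : representations r = 2%N by [].
have le2 i : i \in W -> (2 <= representations i ?= iff (representations i == 2))%N.
  by move=> iW; split; rewrite ?representations_ge2 // eq_sym.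
have := leqif_sum le2; rewrite sum_nat_const sum_card_representations muln2.
move=> -[_]; have /eqP -> : #|W|.*2 == (n * n.-1)%N.
  by rewrite eqn_leq card_restricted_sumset_le.
rewrite eqxx => /esym/forall_inP/(_ _ rW)/eqP//.
Qed.

End Representations.

Lemma card_roots_mult (F : finFieldType) (B : {set F}) (r d : nat) (q : {poly F}) :
  q != 0 -> (size q <= d)%N -> {in B, forall b, ('X - b%:P) ^+ r %| q} ->
  (#|B| * r < d)%N.
Proof.
move=> q0 sq Bq; apply: leq_trans sq.
rewrite cardE -size_prod_XsubC_exp; apply: dvdp_leq => //.
apply: dvdp_prod_XsubC_exp; first exact: enum_uniq.
by move=> b; rewrite mem_enum; apply: Bq.
Qed.

(** * Power sums over the roots of X^q - c *)

Section PowerSums.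

Variables (F : finFieldType) (B : {set F}) (c : F).
Local Notation q := #|B|.
Hypothesis q_neq0 : q%:R != 0 :> F.
Hypothesis c_neq0 : c != 0.
Hypothesis Bc : {in B, forall a, a ^+ q = c}.

Lemma card_roots_gt0 : (0 < q)%N.
Proof. by case: (posnP q) q_neq0 => // ->; rewrite mulr0n eqxx. Qed.

Lemma vanishing_poly_roots : vanishing_poly B = 'X^q - c%:P.
Proof.
apply/eqP; rewrite -subr_eq0; apply/eqP.
apply: (@poly_vanishing_eq0 _ B) => [|a aB]; last first.
  have /eqP ga : (vanishing_poly B).[a] == 0 by rewrite vanishing_poly_eq0.
  by rewrite !(hornerD, hornerN) ga hornerXn hornerC Bc // subrr subr0.
apply/leq_sizeP => j qj; rewrite !coefB coefXn coefC.
rewrite (gtn_eqF (leq_trans card_roots_gt0 qj)) subr0.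
have [->|jq] := eqVneq j q.
  have := monicP (monic_vanishing_poly B).
  by rewrite lead_coefE size_vanishing_poly /= => ->; rewrite subrr.
by rewrite nth_default ?subr0 // size_vanishing_poly; lia.
Qed.

(** Here g'(a) = q a^(q - 1) = q c / a, so a^k is q c times the weight of a times a^(k - 1), and
    [sum_weight] applies in degree k - 1 < q - 1. *)
Lemma sum_exp_roots_eq0 k : (0 < k < q)%N -> \sum_(a in B) a ^+ k = 0.
Proof.
case/andP=> k0 kq; have q0 := card_roots_gt0.
have := @sum_weight _ B 'X^(k.-1); rewrite size_polyXn coefXn.
rewrite (_ : _ == _ = false); last by lia.
rewrite mulr0n => w0.
transitivity (q%:R * c * \sum_(a in B) weight B a * 'X^(k.-1).[a]); last first.
  by rewrite w0 ?mulr0 //; lia.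
rewrite mulr_sumr; apply: eq_bigr => a aB; rewrite hornerXn.
have := deriv_vanishing_poly aB; rewrite vanishing_poly_roots derivB derivC subr0.
rewrite derivXn hornerMn hornerXn => wa.
have qwa : q%:R * c * weight B a = a.
  transitivity (a * (weight B a * (a ^+ q.-1 *+ q))).
    by rewrite -(Bc aB) -{2}(prednK q0) exprS -[a ^+ q.-1 *+ q]mulr_natl; ring.
  by rewrite wa mulfV ?mulr1 ?weight_neq0.
by rewrite mulrA qwa -exprS prednK.
Qed.

(** In the binomial expansion only i = 0 and i = q survive, each contributing q (q c). *)
Lemma sum_sum_exp_roots :
  \sum_(x in B) \sum_(y in B) (x + y) ^+ q = 2%:R * (q%:R * (q%:R * c)).
Proof.
have q0 := card_roots_gt0.
have B0 : \sum_(x in B) x ^+ 0 = q%:R by under eq_bigr do rewrite expr0; rewrite sumr_const.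
have Bq : \sum_(x in B) x ^+ q = q%:R * c.
  by under eq_bigr => x xB do rewrite Bc //; rewrite sumr_const mulr_natl.
transitivity (\sum_(i < q.+1)
    ((\sum_(x in B) x ^+ (q - i)) * (\sum_(y in B) y ^+ i)) *+ 'C(q, i)).
  under eq_bigr do under eq_bigr do rewrite exprDn.
  under eq_bigr do rewrite exchange_big /=.
  rewrite exchange_big /=; apply: eq_bigr => i _.
  rewrite mulr_suml -sumrMnl; apply: eq_bigr => x _.
  by rewrite mulr_sumr -sumrMnl.
rewrite (bigD1 ord0) //= (bigD1 ord_max) /=; last first.
  by rewrite -val_eqE /= -lt0n.
rewrite [X in _ + (_ + X)]big1 => [|i /andP[]].
  by rewrite bin0 binn subn0 subnn B0 Bq !mulr1n addr0; ring.
rewrite -!val_eqE /= => i0 iq; have iltq := ltn_ord i.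
by rewrite (@sum_exp_roots_eq0 i) ?mulr0 ?mul0rn // lt0n i0 ltn_neqAle iq.
Qed.

End PowerSums.

Lemma one_residue p : 1 \in quadratic_residues p.
Proof. by rewrite inE oner_neq0; apply/existsP; exists 1; rewrite expr1n. Qed.

(** With n = k + 1 the hypothesis is n^2 - n + 1 = 0, a factor of n^3 + 1. *)
Lemma natr_exp3_eq (K : comNzRingType) k :
  (k.+1 * k).+1%:R = 0 :> K -> k.+1%:R ^+ 3 = -1 :> K.
Proof.
rewrite -addn1 natrD natrM -natr1 => k0; apply/eqP; rewrite -subr_eq0 opprK.
have -> : (k%:R + 1) ^+ 3 + 1 = (k%:R + 2%:R) * ((k%:R + 1) * k%:R + 1%:R) :> K.
  by ring.
by rewrite k0 mulr0.
Qed.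

Lemma odd_half_bounds h q r : q = r.*2.+1 -> (2 < q)%N ->
  [/\ (0 < r)%N, (r.+1 < q)%N, (r + r < q)%N & ((h + r + r).+2 <= h.+1 + q)%N].
Proof. by move=> -> q3; split; lia. Qed.

(** Writing 2h = v q, the bounds give q <= v <= q + 1, and v = q is excluded by parity. *)
Lemma half_eq_of_dvd p h q r : p = h.*2.+1 -> q = r.*2.+1 -> (2 < q)%N ->
  (q %| p.-1)%N -> (q.+1 * r <= h)%N -> (h.*2 <= q.+1 * q)%N -> p = (q.+1 * q).+1.
Proof.
move=> -> qE q3 /dvdnP[v /= vE] rh hq; have vq : (v <= q.+1)%N by nia.
have qv : (q <= v)%N by nia.
have : v != q by apply: contra_eqN vE => /eqP ->; rewrite qE; lia.
by move=> vnq; have -> : h.*2 = (q.+1 * q)%N; [nia|].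
Qed.

(** * The full sumset: A + A = R *)

Section Sumset.

Variable p : nat.
Hypothesis p_prime : prime p.
Hypothesis p_odd : odd p.
Local Notation F := 'F_p.
Local Notation h := p./2.
Local Notation R := (quadratic_residues p).
Variable A : {set F}.
Hypothesis AR : sumset A = R.
Variable n : nat.
Hypothesis cardA : #|A| = n.

Lemma sum_residue a b : a \in A -> b \in A -> a + b \in R.
Proof. by move=> aA bA; rewrite -AR; apply/imset2P; exists a b. Qed.

Lemma sumset_mem : exists b, b \in A.
Proof.
have := one_residue p; rewrite -AR => /imset2P[a b aA _ _].
by exists a.
Qed.

Lemma card_sumset_le : (h.*2 <= n * n.+1)%N.
Proof.
rewrite -(card_residues p_prime p_odd).
have sub : R \subset restricted_sumset A :|: [set a + a | a in A].
  rewrite -AR; apply/subsetP => _ /imset2P[a b aA bA ->]; rewrite inE.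
  have [->|ab] := eqVneq a b; last by rewrite mem_restricted_sumset.
  by apply/orP; right; apply/imsetP; exists b.
have le1 : (#|R| <= #|restricted_sumset A| + #|A|)%N.
  apply: leq_trans (subset_leq_card sub) _.
  by rewrite (leq_trans (leq_card_setU _ _)) // leq_add2l leq_imset_card.
have -> : (n * n.+1 = n * n.-1 + n.*2)%N by case: (n) => // k; rewrite /=; lia.
rewrite -leq_double doubleD in le1; apply: leq_trans le1 _.
by rewrite cardA leq_add2r -cardA card_restricted_sumset_le.
Qed.

(** The polynomial has n zeros of order n and size at most h + 1. It is nonzero because its Taylor
    coefficient of order n involves a binomial with top h + n - 1 < p. *)
Lemma card_sqr_le : (n * n <= h)%N.
Proof.
have [b bA] := sumset_mem; have h0 := half_p_gt0 p_prime p_odd.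
have An a : a \in A -> {in A, forall c, (c + a) ^+ h = 1}.
  by move=> aA c cA; apply: residue_exp_half; rewrite ?sum_residue.
have b2 : b + b != 0 by apply: (@residue_neq0 p); apply: sum_residue.
have nh : (n <= h)%N.
  rewrite -(card_residues p_prime p_odd) -cardA -(card_imset _ (addrI b)).
  by apply: subset_leq_card; apply/subsetP => _ /imsetP[a aA ->]; apply: sum_residue.
have n0 : (0 < n)%N by rewrite -cardA; apply/card_gt0P; exists b.
have cardA1 : #|A| = n.-1.+1 by rewrite prednK.
pose T := shifted_stepanov h A n.-1 0.
have T0 : T != 0.
  apply/eqP => T0; have := coef_shifted_stepanov_r0 cardA1 (An b bA) h0 bA b2.
  rewrite -/T T0 comp_poly0 coef0 => /esym/eqP.
  rewrite -mulr_natl mulf_eq0 oppr_eq0 invr_eq0 vanishing_poly_eq0.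
  have Ab : {in A, forall a, a != b -> (a + b) ^+ h = 1}.
    by move=> a aA _; apply: An.
  rewrite (negPf (oppr_notin Ab h0 b2)) orbF; apply/negP.
  by apply: Fp_bin_neq0 => //; have := half_p p_odd; lia.
rewrite -ltnS -{1}cardA; apply: (card_roots_mult T0).
  by apply: size_shifted_stepanov; rewrite // cardA1; lia.
by move=> a aA; rewrite -(prednK n0); apply: (dvdp_shifted_stepanov_r0 cardA1 (An a aA)).
Qed.

Lemma sumset_odd : p = 3%N /\ A = [set 2%:R].
Proof.
have [a aA] := sumset_mem; have n0 : (0 < n)%N by rewrite -cardA; apply/card_gt0P; exists a.
have h0 := half_p_gt0 p_prime p_odd.
have n1 : n = 1%N by have := card_sumset_le; have := card_sqr_le; nia.
have h1 : h = 1%N by have := card_sumset_le; rewrite n1; lia.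
have p3 : p = 3%N by have := half_p p_odd; lia.
split=> //; have /eqP/cards1P[c Ac] : #|A| = 1%N by rewrite cardA.
move: (aA); rewrite Ac inE => /eqP ac; rewrite -ac; congr [set _].
have : (a + a) ^+ h = 1.
  by apply: residue_exp_half; rewrite // sum_residue.
rewrite h1 expr1 => aa.
have t0 : 3%:R = 0 :> F by apply/eqP; rewrite Fp_nat_eq0 // p3.
(* Modulo 3, a = 2 (2a), and 2a = 1. *)
transitivity (2%:R * (a + a) - 3%:R * a); first by ring.
by rewrite aa t0; ring.
Qed.

End Sumset.

Lemma sumset_residues p (p_prime : prime p) (A : {set 'F_p}) :
  sumset A = quadratic_residues p -> p = 3%N /\ A = [set 2%:R].
Proof.
move=> AR; case: (even_prime p_prime) => [p2|p_odd]; last exact: sumset_odd (erefl _).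
have [a aA] := sumset_mem AR; have /residue_neq0/negP[] := sum_residue AR aA aA.
by rewrite -mulr2n -mulr_natl mulf_eq0 Fp_nat_eq0 // {1}p2.
Qed.

(** * The restricted sumset over odd p *)

Section Restricted.

Variable p : nat.
Hypothesis p_prime : prime p.
Hypothesis p_odd : odd p.
Local Notation F := 'F_p.
Local Notation h := p./2.
Local Notation R := (quadratic_residues p).
Variable A : {set F}.
Hypothesis AR : restricted_sumset A = R.
Variable n : nat.
Hypothesis cardA : #|A| = n.
Local Notation g := (vanishing_poly A).

Let h_gt0 : (0 < h)%N := half_p_gt0 p_prime p_odd.

Lemma restricted_sum_residue a b : a \in A -> b \in A -> a != b -> a + b \in R.
Proof. by rewrite -AR; apply: mem_restricted_sumset. Qed.

Lemma restricted_sum_exp b : b \in A ->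
  {in A, forall a, a != b -> (a + b) ^+ h = 1}.
Proof. by move=> bA a aA ab; apply: residue_exp_half; rewrite ?restricted_sum_residue. Qed.

Lemma half_p_le : (h.*2 <= n * n.-1)%N.
Proof. by rewrite -(card_residues p_prime p_odd) -AR -cardA card_restricted_sumset_le. Qed.

Lemma card_A_gt1 : (1 < n)%N.
Proof. by have := half_p_le; have := h_gt0; case: (n) => [|[|k]] //; lia. Qed.

Lemma card_A_le : (n <= h.+1)%N.
Proof.
have [b bA] : exists b, b \in A.
  by apply/card_gt0P; rewrite cardA; have := card_A_gt1; lia.
rewrite -cardA (cardsD1 b A) bA add1n ltnS -(card_residues p_prime p_odd).
rewrite -[X in (X <= _)%N](card_imset _ (addrI b)); apply: subset_leq_card.
apply/subsetP => _ /imsetP[a /setD1P[ab aA] ->].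
by apply: restricted_sum_residue; rewrite // eq_sym.
Qed.

Lemma shifted_stepanov_eq0 : shifted_stepanov h A n./2.-1 n./2 = 0.
Proof.
have n1 := card_A_gt1; have hn := half_p_le; have nE := odd_double_half n.
(* With r = [n./2] and m = r - 1, m + r is n - 2 for odd n and n - 1 for even n, hence the two size
   bounds. *)
apply/eqP/negPn/negP => T0; pose d := (if odd n then h else h.+1).
suff: (#|A| * n./2 < d)%N.
  rewrite cardA.
  by rewrite /d; move: nE hn; case: (odd n) => /= nE hn; nia.
apply: (card_roots_mult T0) => [|b bA].
  by apply: size_shifted_stepanov; rewrite ?cardA /d; move: nE; case: (odd n) => /=; lia.
by apply: dvdp_shifted_stepanov; [exact: restricted_sum_exp|rewrite cardA; lia|lia].
Qed.

Definition gamma : F := 'C(h + n./2.-1, n./2)%:R.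

Lemma gamma_neq0 : gamma != 0.
Proof.
apply: Fp_bin_neq0 => //; have := card_A_gt1; have := card_A_le.
by have := half_p p_odd; lia.
Qed.

(** The Taylor coefficient of order [n./2] of the zero polynomial, computed by
    [coef_shifted_stepanov_edge] and cleared of denominators and powers of 2b. *)
Lemma weight_relation b : b \in A -> b != 0 ->
  ((b + b) ^+ h - 1) * g.[- b] = gamma * ((b + b) * g^`().[b]).
Proof.
move=> bA b0; have b2 := Fp_double_neq0 p_prime p_odd b0.
have Ab := restricted_sum_exp bA.
have gb : g.[- b] != 0 by rewrite vanishing_poly_eq0 (oppr_notin Ab).
have w0 := weight_neq0 A b.
have rE : n./2 = n./2.-1.+1 by rewrite prednK //; have := card_A_gt1; lia.
have := @coef_shifted_stepanov_edge _ h A b Ab bA h_gt0 b2 n./2.-1.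
rewrite -rE shifted_stepanov_eq0 comp_poly0 coef0.
rewrite deriv_vanishing_poly // -mulr_natr -/gamma => e.
have {}e := e ltac:(rewrite cardA; have := card_A_gt1; lia).
have : (b + b) ^+ n./2.-1 * (((b + b) ^+ h - 1) * g.[- b]) =
  (b + b) ^+ n./2.-1 * (gamma * ((b + b) / weight A b)).
  move/esym/eqP: e; rewrite subr_eq0 => /eqP e.
  transitivity (weight A b * (b + b) ^+ n./2.-1 * ((b + b) ^+ h - 1) * g.[- b] / weight A b).
    by field.
  rewrite e {1}rE exprSr; field; exact/andP.
by move/mulfI; apply; rewrite expf_neq0.
Qed.

Lemma double_nonresidue b : b \in A -> b != 0 -> (b + b) ^+ h = -1.
Proof.
move=> bA b0; have b2 := Fp_double_neq0 p_prime p_odd b0.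
apply: Fp_exp_half => //; apply/eqP => bh; have /esym/eqP := weight_relation bA b0.
rewrite bh subrr mul0r mulf_eq0 (negPf gamma_neq0) mulf_eq0 (negPf b2).
by rewrite deriv_vanishing_poly // invr_eq0 (negPf (weight_neq0 _ _)).
Qed.

Lemma weight_reflection : {in A, forall b, g.[- b] = - gamma * (b * g^`().[b])}.
Proof.
move=> b bA; have [b0|b0] := eqVneq b 0.
  rewrite b0 oppr0 mul0r mulr0; apply/eqP.
  by rewrite vanishing_poly_eq0 -b0.
have := weight_relation bA b0; rewrite double_nonresidue // => e.
apply: (mulfI (Fp_two_neq0 p_prime p_odd)).
transitivity (- ((-1 - 1) * g.[- b])); first by ring.
by rewrite e; ring.
Qed.

Let natF_neq0 k : (0 < k <= n)%N -> k%:R != 0 :> F.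
Proof.
by move=> kn; apply: Fp_nat_neq0 => //; have := card_A_le; have := half_p p_odd; lia.
Qed.

Let natF_neq0_card k : (0 < k <= #|A|)%N -> k%:R != 0 :> F.
Proof. by rewrite cardA; apply: natF_neq0. Qed.

Let card_A_gt1' : (1 < #|A|)%N.
Proof. by rewrite cardA card_A_gt1. Qed.

(** Off the diagonal each residue occurs exactly twice, giving twice a vanishing power sum over R;
    only the terms (2x)^k remain. *)
Lemma double_sum_exp k : (0 < k < h)%N -> (n * n.-1 <= h.*2)%N ->
  \sum_(x in A) \sum_(y in A) (x + y) ^+ k = 2%:R ^+ k * \sum_(x in A) x ^+ k.
Proof.
move=> kh nh.
have := @sum_restricted_sums p A F (fun x => x ^+ k).
rewrite AR card_residues // cardA sum_residues_exp // mul0rn => /(_ nh) s0.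
rewrite mulr_sumr -[RHS]addr0 -[X in _ + X]s0 -big_split /=.
apply: eq_bigr => x xA; rewrite (bigD1 x) //= -exprMn mulr_natl mulr2n.
by congr (_ + _); apply: eq_bigl => y; rewrite eq_sym.
Qed.

(* Combining [2 ^ (n - 1) = n] with [n ^ 3 = -1] and Fermat's
   [2 ^ (n (n - 1)) = 1] gives [(-1) ^ n = 1]. *)
Lemma restricted_odd : odd n ->
  [/\ p = 7%N, n = 3%N & A \subset [set b | b ^+ 3 == -1]].
Proof.
move=> no; have n1 := card_A_gt1.
have [|c c0 Ac] := reflection_odd gamma_neq0 natF_neq0_card card_A_gt1' weight_reflection.
  by rewrite cardA.
rewrite cardA in Ac.
have A0 b : b \in A -> b != 0.
  move=> bA; apply: contraNneq c0 => b0; rewrite -(Ac b bA) b0 expr0n.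
  by rewrite gtn_eqF // ltnW.
have nE : n = n./2.*2.+1 by rewrite -[LHS]odd_double_half no.
have [b bA] : exists b, b \in A by apply/card_gt0P; rewrite cardA ltnW.
have b2 := Fp_double_neq0 p_prime p_odd (A0 b bA).
(* Its coefficient of order [n./2] at [b] contains (2b)^h - 1 = -2. *)
have T0 : shifted_stepanov h A n./2 n./2 != 0.
  apply/eqP => T0.
  have := @coef_shifted_stepanov_diag _ h A b (restricted_sum_exp bA) bA n./2 n./2.
  rewrite T0 comp_poly0 coef0 double_nonresidue ?A0 // cardA => e.
  have {e} /esym/eqP := e ltac:(lia) ltac:(lia) (leqnn _).
  rewrite !mulf_eq0 (negPf (weight_neq0 _ _)) expf_eq0 (negPf b2) andbF /=.
  by rewrite subr_eq0 eq_sym (negPf (Fp_one_neq_opp p_prime p_odd)).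
have nh : (n * n./2 <= h)%N.
  rewrite -ltnS -{1}cardA; apply: (card_roots_mult T0) => [|a aA].
    by apply: size_shifted_stepanov; rewrite ?cardA; lia.
  by apply: dvdp_shifted_stepanov; [exact: restricted_sum_exp|rewrite cardA; lia|lia].
have hE : h = (n * n./2)%N by have := half_p_le; nia.
have pE : p = (n * n.-1).+1 by have := half_p p_odd; nia.
(* The power sum comparison with exponent n needs n < h, which fails for n = 3, where h = 3. *)
have [n3|n3] := eqVneq n 3.
  have h3 : h = 3%N by rewrite hE n3.
  have p7 : p = 7%N by rewrite pE n3.
  split=> //; apply/subsetP => a aA; rewrite inE.
  have := double_nonresidue aA (A0 a aA); rewrite h3 => <-.
  have e7 : 7%:R = 0 :> F by apply/eqP; rewrite Fp_nat_eq0 // p7.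
  rewrite -subr_eq0 (_ : _ - _ = - 7%:R * a ^+ 3); last by ring.
  by rewrite e7 oppr0 mul0r.
have n0 : n%:R != 0 :> F by apply: natF_neq0; lia.
have := double_sum_exp (k := n); rewrite (eq_bigr (fun=> c) Ac) sumr_const cardA.
have := @sum_sum_exp_roots _ A c; rewrite cardA => /(_ n0 c0 Ac) -> e.
have {}e := e ltac:(nia) ltac:(nia).
have two0 := Fp_two_neq0 p_prime p_odd.
(* The double sum gives 2 n^2 c = 2^n n c; cancel 2 n c. *)
have {}e : 2%:R ^+ n.-1 = n%:R :> F.
  have nc0 : 2%:R * (n%:R * c) != 0 by rewrite !mulf_neq0.
  have twon : 2%:R ^+ n = 2%:R * 2%:R ^+ n.-1 :> F by rewrite -exprS prednK // ltnW.
  apply: (mulfI nc0); transitivity (2%:R ^+ n * (c *+ n)).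
    by rewrite twon -[c *+ n]mulr_natl; ring.
  by rewrite -e; ring.
have p0 : (n * n.-1).+1%:R = 0 :> F by rewrite -pE; apply/eqP; rewrite Fp_nat_eq0.
have n3E : n%:R ^+ 3 = -1 :> F.
  by rewrite -{1}(prednK (ltnW n1)); apply: natr_exp3_eq; rewrite prednK // ltnW.
have : ((2%:R ^+ n.-1) ^+ 3) ^+ n = 1 :> F.
  rewrite -!exprM (_ : (n.-1 * (3 * n) = p.-1 * 3)%N); last by rewrite pE /=; lia.
  by rewrite exprM Fp_exp_pred // expr1n.
rewrite e n3E -signr_odd no expr1 => /esym/eqP.
by rewrite (negPf (Fp_one_neq_opp p_prime p_odd)).
Qed.

(* As [6 q (q + 1) = 6 (q - 1) (q + 2) + 12], the relations [2 ^ (6 (q - 1)) = 1]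
   and [2 ^ (q (q + 1)) = 1] give [2 ^ 12 = 1]. *)
Lemma restricted_even : ~~ odd n ->
  0 \in A /\ (p = 3%N /\ n = 2%N \/ p = 13%N /\ n = 4%N /\
  exists c : F, {in A, forall a, a != 0 -> a ^+ 3 = c}).
Proof.
move=> ne; have n1 := card_A_gt1.
have [|A0 [c c0]] :=
    reflection_even gamma_neq0 natF_neq0_card card_A_gt1' weight_reflection.
  by rewrite cardA.
rewrite cardA => Ac; split=> //.
have [n2|n2] := eqVneq n 2.
  by left; split=> //; have := half_p_le; have := half_p p_odd; rewrite n2; lia.
right; have [q nq] : exists q, n = q.+1 by exists n.-1; rewrite prednK // ltnW.
rewrite nq /= in Ac ne n2.
have [r qE] : exists r, q = r.*2.+1.
  by exists q./2; rewrite -[LHS]odd_double_half; case: (odd q) ne.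
have q3 : (2 < q)%N by clear -qE n2 n1 nq; lia.
have q_gt0 : (0 < q)%N by rewrite qE.
have [r0 r1q rrq hrq] := odd_half_bounds h qE q3.
(* The weights are taken on [B], of odd size q, but zeros of order r still occur at all n points of
   [A], including 0. *)
pose B := A :\ 0.
have cardB : #|B| = q by have := cardsD1 0 A; rewrite A0 cardA nq add1n => -[].
have BA b : b \in B -> b \in A by case/setD1P.
have B0 b : b \in B -> b != 0 by case/setD1P.
have [b bB] : exists b, b \in B by apply/card_gt0P; rewrite cardB.
have bA := BA b bB; have b0 := B0 b bB.
have b2 := Fp_double_neq0 p_prime p_odd b0.
have Bexp x : x \in A -> {in B, forall a, a != x -> (a + x) ^+ h = 1}.
  by move=> xA a /BA; apply: restricted_sum_exp.
have T0 : shifted_stepanov h B r r != 0.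
  apply/eqP => T0.
  have := @coef_shifted_stepanov_diag _ h B b (Bexp b bA) bB r r.
  rewrite T0 comp_poly0 coef0 double_nonresidue // cardB => e.
  have {e} /esym/eqP := e r0 r1q (leqnn _).
  rewrite !mulf_eq0 (negPf (weight_neq0 _ _)) expf_eq0 (negPf b2) andbF /=.
  by rewrite subr_eq0 eq_sym (negPf (Fp_one_neq_opp p_prime p_odd)).
have nh : (n * r <= h)%N.
  rewrite -ltnS -{1}cardA; apply: (card_roots_mult T0) => [|a aA].
    by apply: size_shifted_stepanov; rewrite ?cardB.
  by apply: dvdp_shifted_stepanov; rewrite ?cardB //; exact: Bexp.
(* The bounds so far leave a gap, (q + 1)(q - 1) <= 2h <= (q + 1) q. Divisibility closes it: the
   quotients x / b are q distinct q-th roots of unity. *)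
have q_dvd : (q %| p.-1)%N.
  have rs_unity : all q.-unity_root [seq x / b | x <- enum B].
    apply/allP => y /mapP[x]; rewrite mem_enum => xB ->.
    by rewrite unity_rootE expr_div_n !Ac ?BA ?B0 // divff.
  have /hasP[z _ zq] : has q.-primitive_root [seq x / b | x <- enum B].
    apply: has_prim_root rs_unity _ _ => //.
      by rewrite map_inj_uniq ?enum_uniq //; apply: mulIf; rewrite invr_eq0.
    by rewrite size_map -cardE cardB.
  rewrite (prim_order_dvd zq) Fp_exp_pred //.
  apply/eqP => z0; have := prim_expr_order zq; rewrite z0 expr0n.
  by rewrite gtn_eqF // => /eqP; rewrite eq_sym oner_eq0.
have pE : p = (q.+1 * q).+1.
  apply: (half_eq_of_dvd (half_p p_odd) qE q3 q_dvd); first by rewrite -nq.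
  by have := half_p_le; rewrite nq.
have hE : h.*2 = (q.+1 * q)%N by apply/succn_inj; rewrite -pE -half_p.
have qh : (0 < q < h)%N by clear -hE q3; nia.
have q0 : q%:R != 0 :> F by apply: natF_neq0; rewrite nq q_gt0 /=.
have Bc : {in B, forall a, a ^+ q = c} by move=> a aB; apply: Ac; [exact: BA|exact: B0].
have sB : \sum_(x in B) x ^+ q = q%:R * c.
  by rewrite (eq_bigr (fun=> c) Bc) sumr_const cardB mulr_natl.
have e0 : 0 ^+ q = 0 :> F by rewrite expr0n gtn_eqF.
have sA : \sum_(x in A) x ^+ q = q%:R * c by rewrite (big_setD1 0) //= e0 add0r.
have := double_sum_exp qh; rewrite sA (big_setD1 0) //=.
have -> : \sum_(y in A) (0 + y) ^+ q = q%:R * c.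
  by under eq_bigr do rewrite add0r.
have -> : \sum_(x in A :\ 0) \sum_(y in A) (x + y) ^+ q =
   q%:R * c + \sum_(x in B) \sum_(y in B) (x + y) ^+ q.
  rewrite -sB -big_split /=; apply: eq_bigr => x _.
  by rewrite (big_setD1 0) //= addr0.
have := @sum_sum_exp_roots _ B c; rewrite cardB => /(_ q0 c0 Bc) -> e.
have two0 := Fp_two_neq0 p_prime p_odd.
(* Pairs with one zero entry give 2 q c, pairs in [B] give 2 q^2 c, and the total is 2^q q c; cancel
   2 q c. *)
have {}e : 2%:R ^+ q.-1 = q.+1%:R :> F.
  have e' : (n * n.-1 <= h.*2)%N by rewrite hE nq.
  have {e'} e := e e'.
  have nc0 : 2%:R * (q%:R * c) != 0 by rewrite !mulf_neq0.
  have twoq : 2%:R ^+ q = 2%:R * 2%:R ^+ q.-1 :> F by rewrite -exprS prednK.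
  apply: (mulfI nc0); transitivity (2%:R ^+ q * (q%:R * c)).
    by rewrite twoq; ring.
  by rewrite -e -natr1; ring.
have p0 : (q.+1 * q).+1%:R = 0 :> F by rewrite -pE; apply/eqP; rewrite Fp_nat_eq0.
have := natr_exp3_eq p0; rewrite -e => e3.
have e6 : (2%:R : F) ^+ (q.-1 * 6) = 1.
  by rewrite (_ : (q.-1 * 6 = q.-1 * 3 * 2)%N) 1?exprM ?exprM ?e3 ?sqrrN ?expr1n // -mulnA.
have e12 : 2%:R ^+ 12 = 1 :> F.
  have : (2%:R : F) ^+ (p.-1 * 6) = 1 by rewrite exprM Fp_exp_pred // expr1n.
  rewrite (_ : (p.-1 * 6 = q.-1 * 6 * (q + 2) + 12)%N); last by rewrite pE; clear -q3; nia.
  by rewrite exprD exprM e6 expr1n mul1r.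
have p13 : p = 13%N.
  (* Factor 2^12 - 1 = 63 * 65; of its primes 3, 5, 7, 13 only 13 has the form q (q + 1) + 1 with q
     >= 3. *)
  have : (63%:R * 65%:R == 0 :> F).
    have -> : 63%:R = 2%:R ^+ 6 - 1 :> F by rewrite -natrX -[1]/(1%:R) -natrB.
    have -> : 65%:R = 2%:R ^+ 6 + 1 :> F by rewrite -natrX natr1.
    by rewrite -subr_sqr -exprM e12 expr1n subrr.
  rewrite mulf_eq0 !Fp_nat_eq0 // => /orP[]pd.
    have : p \in primes 63 by rewrite mem_primes p_prime.
    by rewrite (_ : primes 63 = [:: 3; 7]%N) // !inE; clear -pE q3; nia.
  have : p \in primes 65 by rewrite mem_primes p_prime.
  by rewrite (_ : primes 65 = [:: 5; 13]%N) // !inE; clear -pE q3; nia.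
have q3' : q = 3%N by move: pE; rewrite p13; clear; nia.
split=> //; split; first by rewrite nq q3'.
by exists c => a aA a0; have := Ac a aA a0; rewrite q3'.
Qed.

End Restricted.

(** * Identification of the sets for p = 3, 7 and 13 *)

Lemma subset_seq_eq (T : finType) (A : {set T}) (s : seq T) :
  A \subset s -> (size s <= #|A|)%N -> A =i s.
Proof.
move=> As sA; apply/subset_cardP => //; apply/eqP; rewrite eqn_leq subset_leq_card //.
exact: leq_trans (card_size s) sA.
Qed.

Lemma restricted_set3 (A : {set 'F_3}) :
  restricted_sumset A = quadratic_residues 3 -> 0 \in A -> #|A| = 2%N ->
  A = [set 0; 1].
Proof.
move=> AR A0 A2; apply/setP => y.
rewrite (@subset_seq_eq _ _ [:: 0; 1]) ?A2 // ?inE //.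
apply/subsetP => x xA; have [->|x0] := eqVneq x 0; first by rewrite !inE eqxx.
have := restricted_sum_exp (isT : prime 3) isT AR A0 xA x0.
by rewrite addr0 /= expr1 => ->; rewrite !inE eqxx orbT.
Qed.

Lemma restricted_set7 (A : {set 'F_7}) :
  #|A| = 3%N -> A \subset [set b | b ^+ 3 == -1] -> A = [set 3%:R; 5%:R; 6%:R].
Proof.
move=> A3 /subsetP Asub; apply/setP => y.
rewrite (@subset_seq_eq _ _ [:: 3%:R; 5%:R; 6%:R]) ?A3 // ?inE ?orbA //.
apply/subsetP => x /Asub; rewrite !inE.
by case: x => -[|[|[|[|[|[|[|//]]]]]]].
Qed.

Lemma restricted_set13 (A : {set 'F_13}) (c : 'F_13) :
  restricted_sumset A = quadratic_residues 13 -> 0 \in A -> #|A| = 4%N ->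
  {in A, forall a, a != 0 -> a ^+ 3 = c} ->
  A = [set 0; 1; 3%:R; 9%:R] \/ A = [set 0; 4%:R; 10%:R; 12%:R].
Proof.
move=> AR A0 A4 Ac.
have [b bA b0] : exists2 b, b \in A & b != 0.
  have : (0 < #|A :\ 0%R|)%N by move: A4; rewrite (cardsD1 0) A0 add1n => -[->].
  by case/card_gt0P=> b /setD1P[b0 bA]; exists b.
(* Since 0 is in [A], b = b + 0 is a residue, so c^2 = b^6 = b^h = 1. The cases c = 1 and c = -1
   give the two sets. *)
have c2 : c ^+ 2 == 1.
  have := restricted_sum_exp (isT : prime 13) isT AR A0 bA b0.
  by rewrite addr0 -(Ac b bA b0) -exprM => ->.
have AcE x : x \in A -> (x == 0) || (x ^+ 3 == c).
  by move=> xA; case: eqVneq => //= x0; apply/eqP/Ac.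
move: c2; rewrite sqrf_eq1 => /orP[]/eqP c1; [left|right]; apply/setP => y.
  rewrite (@subset_seq_eq _ _ [:: 0; 1; 3%:R; 9%:R]) ?A4 // ?inE ?orbA //.
  apply/subsetP => x /AcE; rewrite c1 !inE.
  by case: x => -[|[|[|[|[|[|[|[|[|[|[|[|[|//]]]]]]]]]]]]].
rewrite (@subset_seq_eq _ _ [:: 0; 4%:R; 10%:R; 12%:R]) ?A4 // ?inE ?orbA //.
apply/subsetP => x /AcE; rewrite c1 !inE.
by case: x => -[|[|[|[|[|[|[|[|[|[|[|[|[|//]]]]]]]]]]]]].
Qed.

(** * The converse, by evaluation on explicit lists *)

Lemma mem_residues p : prime p ->
  quadratic_residues p =i [seq (k%:R : 'F_p) ^+ 2 | k <- iota 1 p.-1].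
Proof.
move=> p_pr x; rewrite inE; apply/andP/mapP => [[x0 /existsP[y /eqP xy]]|[k]].
  exists (nat_of_ord y); last by rewrite natr_Zp.
  rewrite mem_iota add1n (prednK (prime_gt0 p_pr)).
  have -> : (y < p)%N by rewrite -[X in (_ < X)%N](Fp_cast p_pr) ltn_ord.
  rewrite andbT lt0n.
  by apply: contraNneq x0 => y0; rewrite xy sqrf_eq0 -[y]natr_Zp y0.
rewrite mem_iota add1n (prednK (prime_gt0 p_pr)) => k_bounds ->.
by rewrite sqrf_eq0 Fp_nat_neq0 //; split=> //; apply/existsP; exists k%:R.
Qed.

Lemma mem_restricted_sumset_seq p (A : {set 'F_p}) (s : seq 'F_p) : A =i s ->
  restricted_sumset A =i
    [seq ab.1 + ab.2 | ab <- [seq (a, b) | a <- s, b <- s] & ab.1 != ab.2].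
Proof.
move=> As x; apply/imset2P/mapP => [[a b aA]|[[a b]]].
  rewrite inE => /andP[bA ab] ->; exists (a, b) => //.
  by rewrite mem_filter ab; apply/allpairsP; exists (a, b); rewrite -!As.
rewrite mem_filter /= => /andP[ab /allpairsP[[a' b'] /= [a's b's [ea eb]]]] ->.
by exists a b; rewrite ?inE ?As ?ea ?eb // b's -ea -eb.
Qed.

Lemma restricted_sumset_residues p (A : {set 'F_p}) (s : seq 'F_p) :
  prime p -> A =i s ->
  let S := [seq ab.1 + ab.2 | ab <- [seq (a, b) | a <- s, b <- s] & ab.1 != ab.2] in
  let Q := [seq (k%:R : 'F_p) ^+ 2 | k <- iota 1 p.-1] in
  all (mem Q) S && all (mem S) Q -> restricted_sumset A = quadratic_residues p.
Proof.
move=> p_pr As S Q /andP[/allP SQ /allP QS]; apply/setP => x.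
rewrite mem_residues // (mem_restricted_sumset_seq As).
by apply/idP/idP => [/SQ|/QS].
Qed.

(* For p = 2 the second part fails, since {0,1} has restricted sumset {1} = R;
   "quadratic residues" presupposes an odd prime there. *)
Theorem theorem2 (p : nat) (p_prime : prime p) (A : {set 'F_p}) :
  (sumset A = quadratic_residues p ->
     p = 3%N /\ A = [set 2%:R]) /\
  (odd p ->
     (restricted_sumset A = quadratic_residues p <->
        (p = 3%N /\ A = [set 0; 1]) \/
        (p = 7%N /\ A = [set 3%:R; 5%:R; 6%:R]) \/
        (p = 13%N /\ (A = [set 0; 1; 3%:R; 9%:R] \/
                      A = [set 0; 4%:R; 10%:R; 12%:R])))).
Proof.
split=> [|p_odd]; first exact: sumset_residues.
split=> [AR|].
  have [n cardA] : exists n, #|A| = n by exists #|A|.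
  have [no|ne] := boolP (odd n).
    have [p7 n3 A7] := restricted_odd p_prime p_odd AR cardA no.
    right; left; split=> //; subst p; apply: restricted_set7 => //.
    by rewrite cardA.
  have [A0 [[p3 n2]|[p13 [n4 [c Ac]]]]] := restricted_even p_prime p_odd AR cardA ne.
    left; split=> //; subst p; apply: restricted_set3 => //.
    by rewrite cardA.
  right; right; split=> //; subst p; apply: restricted_set13 Ac => //.
  by rewrite cardA.
case=> [[p3 ->]|[[p7 ->]|[p13 [->|->]]]]; subst p.
- apply: (@restricted_sumset_residues _ _ [:: 0; 1]) => // x.
  by rewrite !inE.
- apply: (@restricted_sumset_residues _ _ [:: 3%:R; 5%:R; 6%:R]) => // x.
  by rewrite !inE orbA.
- apply: (@restricted_sumset_residues _ _ [:: 0; 1; 3%:R; 9%:R]) => // x.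
  by rewrite !inE !orbA.
- apply: (@restricted_sumset_residues _ _ [:: 0; 4%:R; 10%:R; 12%:R]) => // x.
  by rewrite !inE !orbA.
Qed.
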